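(* Let $\zeta\in\mathbb{Z}^n$, $\mathbf{M}\in\mathbb{Z}^{n\times n}$ (not necessarily symmetric), let $\mathbf{W}\in\mathbb{Z}^{n\times n}$ be the matrix with columns $\zeta,\mathbf{M}\zeta,\ldots,\mathbf{M}^{n-1}\zeta$, and let $p$ be a prime. Then $p^2 \nmid \det(\mathbf{W})$ if and only if one of the following two events occurs: 1. $\operatorname{coker}(\mathbf{M} - x\mathbf{I},\, \zeta)_{p,\beta} \cong 0$ for all monic $\beta(x) \in \mathbb{Z}[x]$ with irreducible reduction in $\mathbb{F}_p[x]$. 2. There exists $a\in \mathbb{Z}$ such that one has an isomorphism of $\mathbb{Z}[x]$-modules $$\operatorname{coker}(\mathbf{M} - x\mathbf{I},\, \zeta)_{p, x-a} \cong \mathbb{F}_{p}[x]/(x-a)\mathbb{F}_{p}[x],$$ and $\operatorname{coker}(\mathbf{M} - x\mathbf{I},\, \zeta)_{p,\beta} \cong 0$ for every monic $\beta\in\mathbb{Z}[x]$ with irreducible reduction in $\mathbb{F}_p[x]$ and $\beta \not\equiv x-a \bmod p$.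
   Context: $\operatorname{coker}(\mathbf{M}-x\mathbf{I},\zeta)=\mathbb{Z}[x]^n/\bigl((\mathbf{M}-x\mathbf{I})\mathbb{Z}[x]^n+\mathbb{Z}[x]\zeta\bigr)$ is the cokernel, as a $\mathbb{Z}[x]$-module, of the $n\times(n+1)$ matrix over $\mathbb{Z}[x]$ obtained by appending the column $\zeta$ to $\mathbf{M}-x\mathbf{I}$, with $\mathbf{I}$ the identity. For a prime $p$ and a monic $\beta\in\mathbb{Z}[x]$ with irreducible reduction in $\mathbb{F}_p[x]$, $R_{p,\beta}$ denotes the completion of $\mathbb{Z}[x]$ at the maximal ideal $(p,\beta)$; equivalently the ring of formal series $\sum_{i\ge0}c_i\beta^i$ with $c_i\in\mathbb{Z}_p[x]$, $\deg c_i<\deg\beta$, i.e. $\mathbb{Z}_p[x][[y]]/(y-\beta(x))$. For a $\mathbb{Z}[x]$-module $\mathscr{M}$, $\mathscr{M}_{p,\beta}=\mathscr{M}\otimes_{\mathbb{Z}[x]}R_{p,\beta}$. *)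

(* Defs.v *)
From HB Require Import structures.
From mathcomp Require Import all_boot all_order all_algebra.
From mathcomp Require Import boolp classical_sets functions.
From mathcomp Require Import freeg.

Set Implicit Arguments.
Unset Strict Implicit.
Unset Printing Implicit Defensive.

Import GRing.Theory.

Local Open Scope quotient_scope.
Local Open Scope classical_set_scope.
Local Open Scope ring_scope.

Section QuotientModule.
Variables (A : comNzRingType) (V : lmodType A).
Implicit Types (S : set V).

(* The smallest submodule of V containing S, as a (classical) boolean
   predicate. *)
Definition submod_span S : {pred V} := fun v =>
  `[< forall P : {pred V}, submod_closed P ->
        (forall s, S s -> s \in P) -> v \in P >].

Lemma submod_span_closed S : submod_closed (submod_span S).
Proof.
split=> [|a u v /asboolP hu /asboolP hv].
  by apply/asboolP => P [].
apply/asboolP => P hP sSP; case: (hP) => _; apply; first exact: hu.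
exact: hv.
Qed.

HB.instance Definition _ S :=
  GRing.isSubmodClosed.Build A V (submod_span S) (submod_span_closed S).

(* The quotient of V by the submodule generated by S; when S is itself a
   submodule this is V / S. *)
Definition quot_mod S : Type := Quotient.quot (submod_span S).

Variable S : set V.

HB.instance Definition _ := GRing.Zmodule.on (quot_mod S).
HB.instance Definition _ := Quotient.on (quot_mod S).

Lemma quot_mod_eq (u v : V) :
  (\pi_(quot_mod S) u == \pi_(quot_mod S) v) = (u - v \in submod_span S).
Proof. by rewrite (Quotient.idealrBE (submod_span S) u v). Qed.

Lemma quot_mod_pi_surj (q : quot_mod S) : exists u, q = \pi_(quot_mod S) u.
Proof. by exists (repr q); rewrite reprK. Qed.

Lemma quot_mod_piD :
  {morph \pi_(quot_mod S) : u v / u + v}.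
Proof.
exact: (raddfD (\pi_(Quotient.quot (submod_span S)))).
Qed.

Definition quot_mod_scale (a : A) (q : quot_mod S) : quot_mod S :=
  \pi_(quot_mod S) (a *: repr q).

Lemma quot_mod_piZ (a : A) (u : V) :
  quot_mod_scale a (\pi_(quot_mod S) u) = \pi_(quot_mod S) (a *: u).
Proof.
apply/eqP; rewrite quot_mod_eq -scalerBr rpredZ // -quot_mod_eq.
by rewrite reprK.
Qed.

Lemma quot_mod_scaleA a b q :
  quot_mod_scale a (quot_mod_scale b q) = quot_mod_scale (a * b) q.
Proof. by have [u ->] := quot_mod_pi_surj q; rewrite !quot_mod_piZ scalerA. Qed.

Lemma quot_mod_scale1 : left_id 1 quot_mod_scale.
Proof. by move=> q; have [u ->] := quot_mod_pi_surj q; rewrite quot_mod_piZ scale1r. Qed.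

Lemma quot_mod_scaleDr : right_distributive quot_mod_scale +%R.
Proof.
move=> a q r; have [u ->] := quot_mod_pi_surj q.
have [v ->] := quot_mod_pi_surj r.
by rewrite -quot_mod_piD !quot_mod_piZ scalerDr quot_mod_piD.
Qed.

Lemma quot_mod_scaleDl q : {morph quot_mod_scale^~ q : a b / a + b}.
Proof.
have [u ->] := quot_mod_pi_surj q => a b.
by rewrite !quot_mod_piZ scalerDl quot_mod_piD.
Qed.

HB.instance Definition _ := GRing.Zmodule_isLmodule.Build A (quot_mod S)
  quot_mod_scaleA quot_mod_scale1 quot_mod_scaleDr quot_mod_scaleDl.

End QuotientModule.

Definition mod_iso (A : comNzRingType) (U V : lmodType A) : Prop :=
  exists f : {linear U -> V}, bijective f.

Definition zero_mod (A : comNzRingType) : lmodType A := 'cV[A]_0.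

(* The cokernel A^m / B A^k of the matrix B : A^k -> A^m (column vectors). *)
Definition coker (A : comNzRingType) (m k : nat) (B : 'M[A]_(m, k)) :
    lmodType A :=
  quot_mod (range (fun u : 'cV[A]_k => B *m u)).

(* M (x)_A N: the free A-module on the symbols << (m, n) >>, m in M, n in N,
   modulo the submodule generated by the A-bilinearity relations. *)
Section Tensor.
Variables (A : comNzRingType) (M N : lmodType A).

Let sym (m : M) (n : N) : {freeg (M * N) / A} := << (m, n) >>.

Inductive bilinear_rel : {freeg (M * N) / A} -> Prop :=
| bilinear_addl (m m' : M) (n : N) :
    bilinear_rel (sym (m + m') n - (sym m n + sym m' n))
| bilinear_addr (m : M) (n n' : N) :
    bilinear_rel (sym m (n + n') - (sym m n + sym m n'))
| bilinear_scalel (a : A) (m : M) (n : N) :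
    bilinear_rel (sym (a *: m) n - a *: sym m n)
| bilinear_scaler (a : A) (m : M) (n : N) :
    bilinear_rel (sym m (a *: n) - a *: sym m n).

Definition tensor_mod : lmodType A := quot_mod bilinear_rel.

End Tensor.

(* The I-adic completion lim_k A / I^k, as an A-module. An element is given by
   representatives f k of its components in A / I^k, two families of
   representatives being identified when they agree in every A / I^k. *)
Section Completion.
Variable A : comNzRingType.

Definition ideal_gen (S : set A) : {pred A} := submod_span (S : set A^o).

Fixpoint ideal_exp (I : {pred A}) (k : nat) : {pred A} :=
  if k is k'.+1 then
    ideal_gen [set a * b | a in [set a | a \in I]
                         & b in [set b | b \in ideal_exp I k']]
  else predT.

Variable I : {pred A}.

Lemma ideal_exp_closed k : @submod_closed A A^o (ideal_exp I k).
Proof. by case: k => [|k]; [split | exact: submod_span_closed]. Qed.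

Definition coherent : {pred nat -> A^o} := fun f =>
  `[< forall k, f k.+1 - f k \in ideal_exp I k >].

Lemma coherent_closed : submod_closed coherent.
Proof.
split=> [|a f g /asboolP hf /asboolP hg]; apply/asboolP => k.
  by rewrite subrr; case: (ideal_exp_closed k).
rewrite [X in X \in _](_ : _ = a *: (f k.+1 - f k : A^o) + (g k.+1 - g k)).
  by case: (ideal_exp_closed k) => _; apply.
by rewrite scalerBr opprD addrACA.
Qed.

HB.instance Definition _ :=
  GRing.isSubmodClosed.Build A (nat -> A^o) coherent coherent_closed.

Record coherent_seq : Type := CoherentSeq {
  coherent_val :> nat -> A^o;
  _ : coherent_val \in coherent }.

HB.instance Definition _ := [isSub for coherent_val].
HB.instance Definition _ := [Choice of coherent_seq by <:].
HB.instance Definition _ := [SubChoice_isSubLmodule of coherent_seq by <:].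

Definition completion : lmodType A :=
  quot_mod [set f : coherent_seq | forall k, f k \in ideal_exp I k].

End Completion.

Definition restrict_scalars (A B : comNzRingType) (f : {rmorphism A -> B}) :
  Type := B.

Section RestrictScalars.
Variables (A B : comNzRingType) (f : {rmorphism A -> B}).

HB.instance Definition _ := GRing.Zmodule.on (restrict_scalars f).

Definition restrict_scale (a : A) (b : restrict_scalars f) :
  restrict_scalars f := (f a * (b : B) : B).

Lemma restrict_scaleA a b v :
  restrict_scale a (restrict_scale b v) = restrict_scale (a * b) v.
Proof. by rewrite /restrict_scale rmorphM mulrA. Qed.

Lemma restrict_scale1 : left_id 1 restrict_scale.
Proof. by move=> v; rewrite /restrict_scale rmorph1 mul1r. Qed.

Lemma restrict_scaleDr : right_distributive restrict_scale +%R.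
Proof. by move=> a u v; rewrite /restrict_scale mulrDr. Qed.

Lemma restrict_scaleDl v : {morph restrict_scale^~ v : a b / a + b}.
Proof. by move=> a b; rewrite /restrict_scale rmorphD mulrDl. Qed.

HB.instance Definition _ :=
  GRing.Zmodule_isLmodule.Build A (restrict_scalars f)
    restrict_scaleA restrict_scale1 restrict_scaleDr restrict_scaleDl.

End RestrictScalars.

(* Reduction modulo p; 'F_p is the field with p elements only for p prime. *)
Definition reduce_mod (p : nat) : {rmorphism {poly int} -> {poly 'F_p}} :=
  map_poly (intr : int -> 'F_p).

Definition walk_matrix (n : nat) (M : 'M[int]_n) (zeta : 'cV[int]_n) :
    'M[int]_n :=
  \matrix_(i, j) ((M ^+ j *m zeta) i 0).

(* coker(M - x I, zeta), a Z[x]-module. *)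
Definition walk_coker (n : nat) (M : 'M[int]_n) (zeta : 'cV[int]_n) :
    lmodType {poly int} :=
  coker (row_mx (map_mx polyC M - 'X%:M) (map_mx polyC zeta)).

(* R_{p,beta}, the completion of Z[x] at the ideal (p, beta); only its
   Z[x]-module structure enters the base change below. *)
Definition completion_at (p : nat) (beta : {poly int}) : lmodType {poly int} :=
  completion (ideal_gen [set p%:R; beta]).

Definition mod_compl (V : lmodType {poly int}) (p : nat) (beta : {poly int}) :
    lmodType {poly int} :=
  tensor_mod V (completion_at p beta).

(* F_p[x] / (x - a) F_p[x], as a Z[x]-module. *)
Definition Fp_quot (p : nat) (a : int) : lmodType {poly int} :=
  quot_mod (range (fun g : {poly 'F_p} =>
    (('X - (a%:~R)%:P) * g : restrict_scalars (reduce_mod p)))).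

(* Main.v *)
Require Import Defs.
From HB Require Import structures.
From mathcomp Require Import all_boot all_order all_algebra.
From mathcomp Require Import boolp classical_sets functions.
From mathcomp Require Import freeg ring.

(** Sending x to M identifies coker(M - x I, zeta) with the abelian group
    V = Z^n / W Z^n, on which x acts as M: by Cayley-Hamilton W Z^n is stable
    under M, so killing zeta in Z[x]^n / (M - x I) = Z^n kills exactly W Z^n
    (walk_cls_surj, walk_cls_eq0).  The Smith normal form of W then turns the
    divisibility of det W by p and p^2 into statements on V: p does not divide
    det W iff V = pV, and p^2 does not divide det W iff V / pV is generated by
    one element and pV = p^2 V (det_not_dvd_sqr, coker_mod_p_line).  It remains
    to compare this with the base changes of V to the completions R of Z[x] at
    the ideals I = (p, beta).

    If p^2 does not divide det W, write det W = p^e u with u prime to p.  Every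
    element of 1 + I acts surjectively on R, by the geometric series
    (cmpl_one_sub_surj), so a vector of V killed by such an element dies in the
    base change (base_change_eq0).  When e = 0 the integer u kills V, and a
    multiple of u lies in 1 + I, so all base changes vanish.  When e = 1, V / pV
    is a line over F_p, on which x acts by a scalar a.  Thus (x - a) V is in pV,
    and u (x - a) kills V because u p does.  If beta is not x - a modulo p, then
    u (x - a) is invertible modulo I and the base change vanishes
    (base_change_eq0_other).  If I = (p, x - a), the line V / pV yields a map
    from the base change onto F_p[x] / (x - a).  It is injective because
    R = Z[x] + I R (cmpl_const_mod_gen2) reduces every tensor to an integer
    multiple of a single one (base_change_Fp).

    Conversely, the base change of V maps onto V / K for every submodule K
    containing some I^k V (base_change_quot), which transfers annihilators and
    generators of the base change to V / K.  If the base change at beta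
    vanishes, then V = beta V + pV; if it is F_p[x] / (x - a), it is killed by
    p and by x - a.  Factoring the characteristic polynomial of M, which kills
    V, into irreducibles modulo p (monic_pow_sub) gives V = pV in the first
    event and (x - a)^m V in pV for some m in the second.  Thus, in the second
    event, I^m V is in pV, so K = pV is allowed and (x - a) V is in pV; hence
    I^2 V is in p^2 V, so K = p^2 V is allowed and pV = p^2 V; and V / pV, a
    quotient of the base change, has one generator
    (local_structure_of_base_change_Fp). *)

Set Implicit Arguments.
Unset Strict Implicit.
Unset Printing Implicit Defensive.

Import GRing.Theory.

Local Open Scope quotient_scope.
Local Open Scope classical_set_scope.
Local Open Scope ring_scope.

(** * Quotients and tensor products *)

Lemma linear_bundle (A : comNzRingType) (U V : lmodType A) (f : U -> V) :
  linear f -> exists g : {linear U -> V}, g =1 f.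
Proof.
move=> flin.
by exists (HB.pack_for {linear U -> V} f (GRing.isLinear.Build _ _ _ _ f flin)).
Qed.

Lemma inj_surj_bijective (T U : Type) (f : T -> U) :
  injective f -> (forall y, exists x, f x = y) -> bijective f.
Proof.
move=> finj /choice[g fg]; exists g => x; last exact: fg.
by apply: finj; rewrite fg.
Qed.

Section Quotients.
Variables (A : comNzRingType) (V : lmodType A).
Implicit Types (S : set V) (P : {pred V}).

Lemma submod_span_gen S s : S s -> s \in submod_span S.
Proof. by move=> Ss; apply/asboolP => P _; apply. Qed.

Lemma submod_span_ind S P : submod_closed P -> (forall s, S s -> s \in P) ->
  forall v, v \in submod_span S -> v \in P.
Proof. by move=> Pcl SP v /asboolP; apply. Qed.

Lemma quot_mod_pi_eq0 S v : (\pi_(quot_mod S) v = 0) <-> v \in submod_span S.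
Proof.
have <- : \pi_(quot_mod S) 0 = 0.
  exact: (raddf0 (\pi_(Quotient.quot (submod_span S)))).
rewrite -[v in v \in _]subr0 -quot_mod_eq; split=> [->|/eqP//].
exact: eqxx.
Qed.

Lemma quot_mod_pi_linear S : linear (fun v : V => \pi_(quot_mod S) v).
Proof. by move=> a u v; rewrite quot_mod_piD -quot_mod_piZ. Qed.

Lemma quot_mod_piZ_scale S a v :
  a *: \pi_(quot_mod S) v = \pi_(quot_mod S) (a *: v).
Proof. exact: quot_mod_piZ. Qed.

Lemma quot_mod_lift S (U : lmodType A) (phi : {linear V -> U}) :
  (forall s, S s -> phi s = 0) ->
  exists psi : {linear quot_mod S -> U},
    forall v, psi (\pi_(quot_mod S) v) = phi v.
Proof.
move=> phiS.
have ker v : v \in submod_span S -> phi v = 0.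
  move=> vS; apply/eqP; move: v vS.
  apply: (@submod_span_ind S (fun v => phi v == 0)) => [|s /phiS/eqP//].
  split=> [|a u v /eqP u0 /eqP v0]; first by rewrite unfold_in linear0.
  by rewrite unfold_in linearP u0 v0 scaler0 addr0.
have pi v : phi (repr (\pi_(quot_mod S) v)) = phi v.
  apply/eqP; rewrite -subr_eq0 -linearB ker // -quot_mod_eq reprK.
  exact: eqxx.
have [psi psiE] : exists psi : {linear quot_mod S -> U}, psi =1 phi \o repr.
  apply: linear_bundle => a q r.
  have [u ->] := quot_mod_pi_surj q; have [v ->] := quot_mod_pi_surj r.
  by rewrite /= -quot_mod_pi_linear !pi linearP.
by exists psi => v; rewrite psiE /= pi.
Qed.

End Quotients.

Section TensorTheory.
Variables (A : comNzRingType) (M N : lmodType A).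

Definition tens (m : M) (n : N) : tensor_mod M N :=
  \pi_(quot_mod (@bilinear_rel A M N)) << (m, n) >>.

Lemma tensDl m m' n : tens (m + m') n = tens m n + tens m' n.
Proof.
rewrite /tens -quot_mod_piD; apply/eqP; rewrite quot_mod_eq.
exact/submod_span_gen/bilinear_addl.
Qed.

Lemma tensDr m n n' : tens m (n + n') = tens m n + tens m n'.
Proof.
rewrite /tens -quot_mod_piD; apply/eqP; rewrite quot_mod_eq.
exact/submod_span_gen/bilinear_addr.
Qed.

Lemma tensZl a m n : tens (a *: m) n = a *: tens m n.
Proof.
rewrite /tens [RHS]quot_mod_piZ_scale; apply/eqP; rewrite quot_mod_eq.
exact/submod_span_gen/bilinear_scalel.
Qed.

Lemma tensZr a m n : tens m (a *: n) = a *: tens m n.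
Proof.
rewrite /tens [RHS]quot_mod_piZ_scale; apply/eqP; rewrite quot_mod_eq.
exact/submod_span_gen/bilinear_scaler.
Qed.

Lemma tens0l n : tens 0 n = 0.
Proof. by rewrite -(scale0r 0) tensZl scale0r. Qed.

(** A pure tensor absorbs its coefficient, so sums of pure tensors without
    coefficients already exhaust the tensor product. *)
Lemma tens_ind (P : tensor_mod M N -> Prop) :
  P 0 -> (forall s t, P s -> P t -> P (s + t)) -> (forall m n, P (tens m n)) ->
  forall t, P t.
Proof.
move=> P0 PD Pt t; have [u ->] := quot_mod_pi_surj t.
rewrite -[u]freeg_sumE; elim: (dom u) => [|[m n] s IHs].
  by rewrite big_nil (_ : \pi_ _ _ = 0) //; apply/quot_mod_pi_eq0/rpred0.
rewrite big_cons quot_mod_piD; apply: PD => //.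
have -> : << coeff (m, n) u *g (m, n) >> = coeff (m, n) u *: << (m, n) >>
          :> {freeg (M * N) / A}.
  apply/eqP/freeg_eqP => x; rewrite coeffZ !coeffU mul1r //.
by rewrite -quot_mod_piZ_scale -tensZl.
Qed.

Lemma tens_lift (U : lmodType A) (b : M -> N -> U) :
  (forall n, linear (b^~ n)) -> (forall m, linear (b m)) ->
  exists psi : {linear tensor_mod M N -> U}, forall m n, psi (tens m n) = b m n.
Proof.
move=> bl br.
have [phi phiE] : exists phi : {linear {freeg (M * N) / A} -> U},
    phi =1 fglift (fun x => b x.1 x.2).
  apply: linear_bundle => a u v.
  set f := fglift _.
  have fB x y : f (x - y) = f x - f y by apply: lift_is_additive.
  have f0 : f 0 = 0 by have := fB 0 0; rewrite !subrr.
  have fD x y : f (x + y) = f x + f y.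
    have fN : f (- y) = - f y by rewrite -[- y]sub0r fB f0 sub0r.
    by rewrite -[y in LHS]opprK fB fN opprK.
  rewrite fD; congr (_ + _); rewrite -[u]freeg_sumE.
  elim: (dom u) => [|x s IHs]; first by rewrite big_nil scaler0 f0 scaler0.
  rewrite big_cons scalerDr !fD scalerDr IHs; congr (_ + _).
  have -> : a *: << coeff x u *g x >> = << a * coeff x u *g x >>.
    by apply/eqP/freeg_eqP => y; rewrite coeffZ !coeffU mulrA.
  by rewrite /f !liftU scalerA.
have phiU m n : phi << (m, n) >> = b m n by rewrite phiE liftU scale1r.
have [|psi psiE] := @quot_mod_lift _ _ (@bilinear_rel A M N) U phi.
  move=> s rel_s; apply/eqP; case: s / rel_s => [m m' n|m n n'|a m n|a m n];
    rewrite linearB subr_eq0 ?linearD ?linearZ /= !phiU; apply/eqP.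
  - by have := bl n 1 m m'; rewrite !scale1r.
  - by have := br m 1 n n'; rewrite !scale1r.
  - by have [g gE] := linear_bundle (bl n); have := linearZZ g a m; rewrite !gE.
  - by have [g gE] := linear_bundle (br m); have := linearZZ g a n; rewrite !gE.
by exists psi => m n; rewrite psiE phiU.
Qed.

End TensorTheory.

(** * Powers of an ideal and completions *)

Section IdealPowers.
Variables (A : comNzRingType) (I : {pred A}).
Implicit Types (a b x y : A).

Lemma ideal_exp0 k : 0 \in ideal_exp I k.
Proof. by case: (ideal_exp_closed I k). Qed.

Lemma ideal_expMD k a x y :
  x \in ideal_exp I k -> y \in ideal_exp I k -> a * x + y \in ideal_exp I k.
Proof. by case: (ideal_exp_closed I k) => _; apply. Qed.

Lemma ideal_expMl k a x : x \in ideal_exp I k -> a * x \in ideal_exp I k.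
Proof. by move=> xI; rewrite -[_ * _]addr0 ideal_expMD ?ideal_exp0. Qed.

Lemma ideal_expN k x : x \in ideal_exp I k -> - x \in ideal_exp I k.
Proof. by move=> xI; rewrite -mulN1r ideal_expMl. Qed.

Lemma ideal_expS k a x :
  a \in I -> x \in ideal_exp I k -> a * x \in ideal_exp I k.+1.
Proof. by move=> aI xI; apply: submod_span_gen; exists a => //; exists x. Qed.

Lemma ideal_exp_geom k c : c \in I -> c ^+ k \in ideal_exp I k.
Proof. by move=> cI; elim: k => // k IHk; rewrite exprS ideal_expS. Qed.

End IdealPowers.

Section TwoGenerators.
Variables (A : comNzRingType) (x y : A).
Local Notation I := (ideal_gen [set x; y]).

Lemma ideal_gen2P a : a \in I <-> exists s t, a = s * x + t * y.
Proof.
split=> [|[s [t ->]]]; last first.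
  case: (submod_span_closed (V := A^o) [set x; y]) => z cl.
  apply: (cl); first by apply: submod_span_gen; left.
  rewrite -[_ * _]addr0; apply: (cl) => //.
  by apply: submod_span_gen; right.
move=> aI; apply/asboolP; move: a aI.
apply: (@submod_span_ind A A^o _
   (fun a => `[< exists s t, a = s * x + t * y >])) => [|a].
  split=> [|c u v /asboolP[s [t ->]] /asboolP[s' [t' ->]]]; apply/asboolP.
    by exists 0, 0; rewrite !mul0r addr0.
  exists (c * s + s'), (c * t + t').
  by rewrite -[c *: _]/(c * _) mulrDr !mulrDl !mulrA addrACA.
by case=> ->; apply/asboolP; [exists 1, 0 | exists 0, 1];
  rewrite mul1r mul0r ?addr0 ?add0r.
Qed.

(** The quotients s and t lie one power lower: this precision is what makes
    the series built from them in cmpl_const_mod_gen2 converge. *)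
Lemma ideal_exp_gen2 k a : a \in ideal_exp I k.+1 ->
  exists s t, [/\ s \in ideal_exp I k, t \in ideal_exp I k & a = x * s + y * t].
Proof.
move=> aI; apply/asboolP; move: a aI.
apply: (@submod_span_ind A A^o _ (fun a => `[< exists s t,
   [/\ s \in ideal_exp I k, t \in ideal_exp I k & a = x * s + y * t] >]))
  => [|a].
  split=> [|c u v /asboolP[s [t [sI tI ->]]] /asboolP[s' [t' [s'I t'I ->]]]];
    apply/asboolP.
    by exists 0, 0; rewrite ideal_exp0 !mulr0 addr0.
  exists (c * s + s'), (c * t + t'); split; rewrite ?ideal_expMD //.
  rewrite -[c *: _]/(c * _) !mulrDr ![x * (c * _)]mulrCA.
  by rewrite ![y * (c * _)]mulrCA addrACA.
case=> b /ideal_gen2P[s [t ->]] [c cI <-]; apply/asboolP.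
exists (s * c), (t * c); split; rewrite ?ideal_expMl //.
by rewrite mulrDl -!mulrA [s * _]mulrCA [t * _]mulrCA.
Qed.

End TwoGenerators.

Section CompletionTheory.
Variables (A : comNzRingType) (I : {pred A}).
Local Notation R := (completion I).
Local Notation null :=
  [set f : coherent_seq I | forall k, f k \in ideal_exp I k].

Definition lim_of (f : nat -> A) (cf : f \in coherent I) : R :=
  \pi_(quot_mod null) (CoherentSeq cf).

Lemma coherentP (f : nat -> A) :
  reflect (forall k, f k.+1 - f k \in ideal_exp I k) (f \in coherent I).
Proof. exact: asboolP. Qed.

Lemma lim_of_surj (r : R) :
  exists f (cf : f \in coherent I), r = lim_of cf.
Proof. by have [[f cf] ->] := quot_mod_pi_surj r; exists f, cf. Qed.

Lemma coherent_val_linear : linear (@coherent_val A I : _ -> (nat -> A^o)).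
Proof. exact: (linearP (val : coherent_seq I -> (nat -> A^o))). Qed.

Lemma null_spanP (f : coherent_seq I) :
  f \in submod_span null <-> (forall k, f k \in ideal_exp I k).
Proof.
split=> [|fI]; last exact: submod_span_gen.
move=> fN; apply/asboolP; move: f fN.
apply: (@submod_span_ind A (coherent_seq I) _
  (fun f : coherent_seq I => `[< forall k, f k \in ideal_exp I k >])).
  split=> [|a f g /asboolP fI /asboolP gI]; apply/asboolP => k.
    rewrite -(subrr (0 : coherent_seq I)) -scaleN1r addrC coherent_val_linear.
    by rewrite scaleN1r addNr ideal_exp0.
  by rewrite coherent_val_linear ideal_expMD.
by move=> f fI; apply/asboolP.
Qed.

Lemma lim_of_eq (f g : nat -> A)
    (cf : f \in coherent I) (cg : g \in coherent I) :
  lim_of cf = lim_of cg <-> (forall k, f k - g k \in ideal_exp I k).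
Proof.
split=> [/eqP|fg]; first by rewrite quot_mod_eq => /null_spanP.
by apply/eqP; rewrite quot_mod_eq; apply/null_spanP.
Qed.

Lemma coherentMD a (f g : nat -> A) : f \in coherent I -> g \in coherent I ->
  (fun k => a * f k + g k) \in coherent I.
Proof. by case: (coherent_closed I) => _; apply. Qed.

Lemma lim_ofMD a (f g : nat -> A)
    (cf : f \in coherent I) (cg : g \in coherent I) :
  a *: lim_of cf + lim_of cg = lim_of (coherentMD a cf cg).
Proof.
rewrite /lim_of [a *: _]quot_mod_piZ_scale -[LHS]quot_mod_piD.
by apply/lim_of_eq => k; rewrite subrr ideal_exp0.
Qed.

Lemma coherent_cst a : (fun=> a) \in coherent I.
Proof. by apply/coherentP => k; rewrite subrr ideal_exp0. Qed.

Definition cmpl_const (a : A) : R := lim_of (coherent_cst a).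

Lemma cmpl_const0 : cmpl_const 0 = 0.
Proof. by apply/quot_mod_pi_eq0/null_spanP => k; apply: ideal_exp0. Qed.

Lemma cmpl_constZ a : cmpl_const a = a *: cmpl_const 1.
Proof.
rewrite -[RHS]addr0; rewrite -cmpl_const0.
by rewrite lim_ofMD; apply/lim_of_eq => k; rewrite mulr1 addr0 subrr ideal_exp0.
Qed.

End CompletionTheory.

(** * Base change to a completion *)

Lemma mod_iso_zeroP (A : comNzRingType) (V : lmodType A) :
  mod_iso V (zero_mod A) <-> (forall v : V, v = 0).
Proof.
split=> [[f [g fK _]] v|V0].
  by rewrite -[v]fK -[0]fK; congr g; rewrite (flatmx0 (f v)) (flatmx0 (f 0)).
have [f _] := @linear_bundle A V (zero_mod A) (fun=> 0)
  (fun a _ _ => esym (etrans (addr0 _) (scaler0 _ a))).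
exists f; exists (fun=> 0) => w; last by rewrite [LHS]flatmx0 (flatmx0 w).
by rewrite (V0 w).
Qed.

Section BaseChange.
Variables (A : comNzRingType) (V : lmodType A) (I : {pred A}).
Local Notation R := (completion I).

(** The inverse of 1 - c is the series of the powers of c; its k-th partial sum
    is exact up to c^k, which lies in I^k. *)
Lemma cmpl_one_sub_surj c (r : R) : c \in I -> exists r', r = (1 - c) *: r'.
Proof.
move=> cI; have [f [cf ->]] := lim_of_surj r.
have cg : (fun k => (\sum_(j < k) c ^+ j) * f k) \in coherent I.
  apply/coherentP => k; rewrite big_ord_recr /= mulrDl addrAC -mulrBr.
  apply: ideal_expMD; first exact/coherentP.
  by rewrite mulrC ideal_expMl ?ideal_exp_geom.
exists (lim_of cg); have := lim_ofMD (1 - c) cg (coherent_cst I 0).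
rewrite -/(cmpl_const I 0) cmpl_const0 addr0 => ->; apply/lim_of_eq => k.
rewrite addr0 mulrA.
have -> : (1 - c) * (\sum_(j < k) c ^+ j) = 1 - c ^+ k.
  by rewrite -[LHS]opprK -mulNr opprB -subrX1 opprB.
rewrite mulrBl mul1r opprB addrC subrK.
by rewrite mulrC ideal_expMl ?ideal_exp_geom.
Qed.

Lemma tens_ann0 (v : V) (r : R) c : c \in I -> (1 - c) *: v = 0 -> tens v r = 0.
Proof.
move=> cI cv; have [r' ->] := cmpl_one_sub_surj r cI.
by rewrite tensZr -tensZl cv tens0l.
Qed.

Lemma base_change_eq0 : (forall v : V, exists2 c, c \in I & (1 - c) *: v = 0) ->
  mod_iso (tensor_mod V R) (zero_mod A).
Proof.
move=> annV; apply/mod_iso_zeroP; apply: tens_ind => // [s t -> ->|v r].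
  by rewrite addr0.
by have [c cI cv] := annV v; apply: tens_ann0 cI cv.
Qed.

(** A linear map killing I^k V only sees the k-th component of an element of
    the completion, whatever representative is chosen. *)
Lemma base_change_lift (U : lmodType A) (phi : {linear V -> U}) k :
  (forall a v, a \in ideal_exp I k -> phi (a *: v) = 0) ->
  exists Phi : {linear tensor_mod V R -> U},
    forall v (f : nat -> A) (cf : f \in coherent I),
      Phi (tens v (lim_of cf)) = phi (f k *: v).
Proof.
move=> phiI.
pose rep (r : R) : A := coherent_val (repr r) k.
have repE (f : nat -> A) (cf : f \in coherent I) v :
    phi (rep (lim_of cf) *: v) = phi (f k *: v).
  apply/eqP; rewrite -subr_eq0 -linearB -scalerBl phiI //.
  case E: (repr (lim_of cf)) => [g cg]; rewrite /rep E /=.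
  by have /lim_of_eq : @lim_of A I g cg = lim_of cf by rewrite -[RHS]reprK E.
have [||Phi PhiE] := @tens_lift A V R U (fun v r => phi (rep r *: v)).
- by move=> r a u v; rewrite scalerDr scalerA mulrC -scalerA linearP.
- move=> v a r s; have [f [cf ->]] := lim_of_surj r.
  have [g [cg ->]] := lim_of_surj s.
  by rewrite lim_ofMD !repE scalerDl -scalerA linearP.
by exists Phi => v f cf; rewrite PhiE repE.
Qed.

End BaseChange.

(** The completion R equals A + I R for I = (x, y): every step of a coherent
    sequence after the first value lies in a power of I, hence splits as a
    multiple of x plus a multiple of y, and summing the quotients gives the two
    coordinates. *)
Lemma cmpl_const_mod_gen2 (A : comNzRingType) (x y : A)
    (r : completion (ideal_gen [set x; y])) :
  exists a s t, r = a *: cmpl_const _ 1 + (x *: s + y *: t).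
Proof.
have [f [cf ->]] := lim_of_surj r.
set I := ideal_gen _ in r cf *.
have /choice[s /choice[t st]] : forall k, exists s, exists t,
    [/\ s \in ideal_exp I k, t \in ideal_exp I k & 
        f k.+2 - f k.+1 = x * s + y * t].
  by move=> k; apply: ideal_exp_gen2; apply/coherentP.
pose psum (u : nat -> A) k := \sum_(j < k) u j.
have cs u : (forall k, u k \in ideal_exp I k) -> psum u \in coherent I.
  by move=> uI; apply/coherentP => k; rewrite /psum big_ord_recr addrC addKr.
have cps : psum s \in coherent I by apply: cs => k; case: (st k).
have cpt : psum t \in coherent I by apply: cs => k; case: (st k).
(* Not f 0, which coherence leaves unconstrained: the step from f 0 to f 1 is
   only in I^0, the whole ring. *)
exists (f 1), (lim_of cps), (lim_of cpt).
rewrite -cmpl_constZ -[y *: _]addr0.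
rewrite -(cmpl_const0 I).
rewrite !lim_ofMD -[cmpl_const _ _]scale1r lim_ofMD; apply/lim_of_eq => k.
suff -> : f k - (1 * f 1 + (x * psum s k + (y * psum t k + 0))) = f k - f k.+1.
  by rewrite -opprB ideal_expN //; apply/coherentP.
rewrite mul1r addr0; congr (_ - _).
rewrite /psum; elim: k => [|k IHk]; first by rewrite !big_ord0 !mulr0 !addr0.
rewrite !big_ord_recr /= !mulrDr addrACA [LHS]addrA IHk.
by case: (st k) => _ _ <-; rewrite addrC subrK.
Qed.

Section BaseChangeTests.
Variables (A : comNzRingType) (V : lmodType A) (I : {pred A}).
Local Notation T := (tensor_mod V (completion I)).
Local Notation one := (cmpl_const I 1).

(** The base change surjects onto V / P for every submodule P containing some
    I^k V; this is how information on the base change comes back to V. *)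
Lemma base_change_quot (P : {pred V}) k :
  (forall a v, a \in ideal_exp I k -> a *: v \in P) ->
  exists Phi : {linear T -> quot_mod [set v | v \in P]},
    forall v, Phi (tens v one) = \pi_(quot_mod [set v | v \in P]) v.
Proof.
move=> IP.
have [phi phiE] := linear_bundle (@quot_mod_pi_linear A V [set v | v \in P]).
have [|Phi PhiE] := @base_change_lift A V I _ phi k.
  by move=> a v aI; rewrite phiE; apply/quot_mod_pi_eq0/submod_span_gen/IP.
by exists Phi => v; rewrite PhiE scale1r phiE.
Qed.

Lemma submod_span_id (P : {pred V}) v : submod_closed P ->
  v \in submod_span [set v | v \in P] -> v \in P.
Proof. by move=> Pcl; apply: submod_span_ind. Qed.

Lemma base_change_ann (P : {pred V}) k c : submod_closed P ->
  (forall a v, a \in ideal_exp I k -> a *: v \in P) ->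
  (forall t : T, c *: t = 0) -> forall v, c *: v \in P.
Proof.
move=> Pcl IP cT v; have [Phi PhiE] := base_change_quot IP.
apply: (submod_span_id Pcl); apply/quot_mod_pi_eq0.
by rewrite -PhiE tensZl cT linear0.
Qed.

Lemma base_change_gen (P : {pred V}) k (t0 : T) (C : set A) : submod_closed P ->
  (forall a v, a \in ideal_exp I k -> a *: v \in P) ->
  (forall t : T, exists2 c, C c & t = c *: t0) ->
  exists v0, forall v, exists2 c, C c & v - c *: v0 \in P.
Proof.
move=> Pcl IP t0T; have [Phi PhiE] := base_change_quot IP.
have [v0 v0E] := quot_mod_pi_surj (Phi t0).
exists v0 => v; have [c Cc tE] := t0T (tens v one).
exists c => //; apply: (submod_span_id Pcl).
rewrite -(@quot_mod_eq _ _ [set v | v \in P]) -PhiE tE linearZ /= v0E.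
by rewrite [X in X == _]quot_mod_piZ_scale; apply: eqxx.
Qed.

End BaseChangeTests.

Lemma mulmod_closed (A : comNzRingType) (V : lmodType A) (x y : A) :
  submod_closed (fun v : V => `[< exists s t, v = x *: s + y *: t >]).
Proof.
split=> [|a u v /asboolP[s [t ->]] /asboolP[s' [t' ->]]]; apply/asboolP.
  by exists 0, 0; rewrite !scaler0 addr0.
exists (a *: s + s'), (a *: t + t').
by rewrite !scalerDr !scalerA ![a * _]mulrC addrACA.
Qed.

(** Take for P the submodule I V itself, with k = 1. *)
Lemma base_change0_gen2 (A : comNzRingType) (V : lmodType A) (x y : A) :
  mod_iso (tensor_mod V (completion (ideal_gen [set x; y]))) (zero_mod A) ->
  forall v : V, exists s t, v = x *: s + y *: t.
Proof.
move=> /mod_iso_zeroP T0 v; apply/asboolP.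
rewrite -[v]scale1r.
apply: (base_change_ann (k := 1) (c := 1) (mulmod_closed V x y)).
  move=> a w /ideal_exp_gen2[s [t [_ _ ->]]]; apply/asboolP.
  by exists (s *: w), (t *: w); rewrite scalerDl !scalerA.
by move=> t; apply: T0.
Qed.

(** * Integer matrices modulo a prime and its square *)

Lemma prime_dvdzM (p : nat) (a b : int) : prime p ->
  (p %| a * b)%Z = (p %| a)%Z || (p %| b)%Z.
Proof. by move=> pp; rewrite !dvdzE abszM Euclid_dvdM. Qed.

Lemma prime_not_dvdz_Bezout (p : nat) (u : int) : prime p -> ~~ (p %| u)%Z ->
  exists s t : int, s * u + t * p%:Z = 1.
Proof.
move=> pp; rewrite dvdzE => pu.
have /coprimezP[[s t] /= E] : coprimez u p.
  by rewrite coprimezE coprime_sym prime_coprime.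
by exists s, t.
Qed.

Lemma prime_dvdz_prod (p : nat) (I : finType) (P : pred I) (f : I -> int) :
  prime p -> (p %| \prod_(i | P i) f i)%Z -> exists2 i, P i & (p %| f i)%Z.
Proof.
move=> pp; elim/big_rec: _ => [|i x Pi IHx].
  by rewrite dvdzE dvdn1 => /eqP; case: (p) pp => [|[]].
by rewrite prime_dvdzM // => /orP[pf|/IHx]; first exists i.
Qed.

(** The two ways for p^2 to divide det W, once W is diagonalised: they make the
    cokernel have an element of order p^2, or two independent elements modulo
    p. *)
Lemma sqr_prime_dvdz_prod (p : nat) (I : finType) (f : I -> int) :
  prime p -> ((p ^ 2)%N %| \prod_i f i)%Z ->
  (exists i, ((p ^ 2)%N %| f i)%Z) \/
  (exists i j, [/\ i != j, (p %| f i)%Z & (p %| f j)%Z]).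
Proof.
move=> pp ppf; have pf : (p %| \prod_i f i)%Z.
  by apply: dvdz_trans ppf; rewrite dvdzE /= dvdn_exp.
have [i _ pfi] := prime_dvdz_prod pp pf.
have [pr|npr] := boolP (p %| \prod_(j | j != i) f j)%Z.
  have [j ji pfj] := prime_dvdz_prod pp pr.
  by right; exists i, j; rewrite eq_sym.
left; exists i; move: ppf; rewrite (bigD1 i) //= Gauss_dvdzl //.
by rewrite coprimezE coprimeXl // prime_coprime // -dvdzE.
Qed.

Lemma int_Smith_square (n : nat) (W : 'M[int]_n) :
  exists (L R : 'M[int]_n) (d : 'rV[int]_n),
    [/\ L \in unitmx, R \in unitmx & W = L *m diag_mx d *m R].
Proof.
have [L Lu [R Ru [d _ ->]]] := int_Smith_normal_form W.
exists L, R, (\row_i d`_i); split=> //; congr (_ *m _ *m _).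
by apply/matrixP => i j; rewrite !mxE.
Qed.

Section SmithConsequences.
Variables (n : nat) (W : 'M[int]_n).
Variables (L R : 'M[int]_n) (d : 'rV[int]_n).
Hypotheses (Lu : L \in unitmx) (Ru : R \in unitmx).
Hypothesis WE : W = L *m diag_mx d *m R.

Lemma dvdz_det_Smith k : (k %| \det W)%Z = (k %| \prod_i d 0%R i)%Z.
Proof.
rewrite WE !det_mulmx det_diag; move: Lu Ru; rewrite !unitmxE.
move=> Ldu Rdu; rewrite !dvdzE !abszM.
have abs1 (x : int) : x \is a GRing.unit -> `|x|%N = 1%N.
  by case/orP => /eqP ->.
by rewrite (abs1 _ Ldu) (abs1 _ Rdu) mul1n muln1.
Qed.

(** The i-th row of L^-1 is a linear form on Z^n that is onto Z and descends to
    a form on Z^n / W Z^n with values in Z / d_i; the columns of L form the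
    dual basis (Smith_row_col). *)
Lemma Smith_row i : row i (invmx L) *m W = d 0 i *: row i R.
Proof.
rewrite -row_mul WE !mulmxA mulVmx // mul1mx.
by apply/rowP => j; rewrite !mxE (bigD1 i) //= big1 ?addr0 => [|k ki];
  rewrite mxE ?eqxx // eq_sym (negPf ki) mul0r.
Qed.

Lemma Smith_row_col i j : (row i (invmx L) *m col j L) 0 0 = (i == j)%:R.
Proof.
have -> : row i (invmx L) *m col j L = \matrix_(_, _) ((invmx L *m L) i j).
  by apply/matrixP => a b; rewrite !mxE; apply: eq_bigr => k _; rewrite !mxE.
by rewrite mulVmx // !mxE.
Qed.

End SmithConsequences.

(** If p^2 divides det W, the cokernel of W either maps onto Z / p^2, where
    p is not a multiple of p^2, or maps onto (Z / p)^2, which has no single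
    generator. *)
Lemma det_not_dvd_sqr (n p : nat) (W : 'M[int]_n) : prime p ->
  (exists v0 : 'cV_n, forall v : 'cV_n, exists (m : int) (s t : 'cV_n),
     v = m *: v0 + (p%:Z *: s + W *m t)) ->
  (forall v : 'cV_n, exists s t : 'cV_n,
     p%:Z *: v = (p ^ 2)%N%:Z *: s + W *m t) ->
  ~~ ((p ^ 2)%N%:Z %| \det W)%Z.
Proof.
move=> pp [v0 cyc] pV; apply/negP.
have [L [R [d [Lu Ru WE]]]] := int_Smith_square W.
pose w i (v : 'cV[int]_n) := (row i (invmx L) *m v) 0 0.
have wD i u v : w i (u + v) = w i u + w i v by rewrite /w mulmxDr mxE.
have wZ i a v : w i (a *: v) = a * w i v by rewrite /w -scalemxAr mxE.
have wW i t : exists y, w i (W *m t) = d 0 i * y.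
  rewrite /w mulmxA (Smith_row Lu WE) -scalemxAl.
  by exists ((row i R *m t) 0 0); rewrite mxE.
have wL i j : w i (col j L) = (i == j)%:R by apply: Smith_row_col.
have p1 (y : int) : p%:Z * y <> 1.
  move=> E; have : (p%:Z %| 1)%Z by apply/dvdzP; exists y; rewrite mulrC E.
  by rewrite dvdzE dvdn1 => /eqP; case: (p) pp => [|[]].
rewrite (dvdz_det_Smith Lu Ru WE) => /(sqr_prime_dvdz_prod pp)[[i]|[i [j]]].
  case/dvdzP=> y dE; have [s [t E]] := pV (col i L).
  have := congr1 (w i) E; rewrite wZ wD wZ wL eqxx.
  have [z ->] := wW i t; rewrite dE PoszM => E1.
  apply: (p1 (w i s + y * z)); apply: (@mulfI _ p%:Z).
    by rewrite -lt0n prime_gt0.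
  by rewrite E1; ring.
case=> ij /dvdzP[yi dEi] /dvdzP[yj dEj].
have coord k y v m s t : d 0 k = y * p%:Z ->
    v = m *: v0 + (p%:Z *: s + W *m t) ->
    exists c, w k v = m * w k v0 + p%:Z * c.
  move=> dE ->; have [z zE] := wW k t; exists (w k s + y * z).
  by rewrite !wD !wZ zE dE; ring.
have [m [s [t vi]]] := cyc (col i L); have [m' [s' [t' vj]]] := cyc (col j L).
have [ci] := coord _ _ _ _ _ _ dEi vi; have [cj] := coord _ _ _ _ _ _ dEj vi.
have [ci'] := coord _ _ _ _ _ _ dEi vj; have [cj'] := coord _ _ _ _ _ _ dEj vj.
rewrite !wL !eqxx (negPf ij) eq_sym (negPf ij) => Ejj Eij Eji Eii.
(* Modulo p, the 2 x 2 identity matrix would be the product of the column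
   (m, m') and the row (a, b); its determinant shows that p divides 1. *)
pose a := w i v0; pose b := w j v0.
apply: (p1 (cj' * m * a + ci * m' * b + ci * cj' * p%:Z
            - (ci' * m * b + cj * m' * a + cj * ci' * p%:Z))).
transitivity ((m * a + p%:Z * ci) * (m' * b + p%:Z * cj') -
              (m * b + p%:Z * cj) * (m' * a + p%:Z * ci')); first by ring.
by rewrite -Eii -Ejj -Eij -Eji.
Qed.

(** Exactly one diagonal entry d_i of the Smith form is divisible by p; the
    others are invertible modulo p, so the i-th row of L^-1 is a linear form
    whose kernel modulo p is the image of W. *)
Lemma coker_mod_p_line (n p : nat) (W : 'M[int]_n) : prime p ->
  (p%:Z %| \det W)%Z -> ~~ ((p ^ 2)%N%:Z %| \det W)%Z ->
  exists (w : 'rV[int]_n) (v0 : 'cV[int]_n),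
    [/\ (w *m v0) 0 0 = 1,
        forall t : 'cV_n, (p%:Z %| (w *m (W *m t)) 0%R 0%R)%Z &
        forall v : 'cV_n, (p%:Z %| (w *m v) 0%R 0%R)%Z ->
          exists s t : 'cV_n, v = p%:Z *: s + W *m t].
Proof.
move=> pp; have [L [R [d [Lu Ru WE]]]] := int_Smith_square W.
rewrite !(dvdz_det_Smith Lu Ru WE) => pd npd.
have [i _ pi] := prime_dvdz_prod pp pd.
have npj j : j != i -> ~~ (p%:Z %| d 0%R j)%Z.
  move=> ji; apply: contra npd => pj.
  rewrite (bigD1 i) //= (bigD1 j) //= mulrA dvdz_mulr //.
  by rewrite expnS expn1 PoszM dvdz_mul.
exists (row i (invmx L)), (col i L); split=> [|t|v].
- by rewrite (Smith_row_col Lu) eqxx.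
- by rewrite mulmxA (Smith_row Lu WE) -scalemxAl mxE dvdz_mulr.
move=> pv.
pose c := invmx L *m v.
have /fin_all_exists[f /fin_all_exists[g fg]] : forall j, exists x y : int,
    c j 0 = p%:Z * x + d 0 j * y.
  move=> j; have [->|ji] := eqVneq j i.
    case/dvdzP: pv => x xE; exists x, 0; rewrite mulr0 addr0 mulrC -xE.
    by rewrite -row_mul [RHS]mxE.
  have [s [t st]] := prime_not_dvdz_Bezout pp (npj j ji).
  by exists (t * c j 0), (s * c j 0); rewrite -[LHS]mul1r -st; ring.
exists (L *m \col_j f j), (invmx R *m \col_j g j).
rewrite WE -!mulmxA mulKVmx // scalemxAr -mulmxDr.
rewrite -[LHS](mulKVmx Lu) -/c; congr (L *m _); apply/colP => j.
by rewrite fg mul_diag_mx !mxE.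
Qed.

(** * Reduction of polynomials modulo a prime *)

Lemma monic_irreducible_factor (F : fieldType) (q : {poly F}) :
  (1 < size q)%N ->
  exists b, [/\ b \is monic, irreducible_poly b & b %| q].
Proof.
have [k] := ubnP (size q); elim: k q => // k IHk q le_qk q1.
have [irr|nirr] := pselect (irreducible_poly q).
  have lq0 : lead_coef q != 0.
    by rewrite lead_coef_eq0 -size_poly_gt0 (ltn_trans _ q1).
  have bq : (lead_coef q)^-1 *: q %= q by rewrite eqp_scale ?invr_eq0.
  exists ((lead_coef q)^-1 *: q); split.
  - by rewrite monicE lead_coefZ mulVf.
  - split=> [|d d1 db]; first by rewrite (eqp_size bq).
    rewrite (eqp_trans _ (_ : q %= _)) //; last by rewrite eqp_sym.
    by apply: irr.2 => //; rewrite -(eqp_dvdr _ bq).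
  - by rewrite (eqp_dvdl _ bq).
have [d [d1 dq ndq]] : exists d : {poly F},
    [/\ size d != 1%N, d %| q & ~~ (d %= q)].
  apply: contrapT => nd; apply: nirr; split=> // d d1 dq.
  by apply: contrapT => /negP ndq; apply: nd; exists d.
have q0 : q != 0 by rewrite -size_poly_gt0 (ltn_trans _ q1).
have d0 : d != 0 by apply: contraNneq q0 => d0; rewrite d0 dvd0p in dq.
have ltdq : (size d < size q)%N.
  by rewrite ltn_neqAle dvdp_leq // andbT dvdp_size_eqp.
have [||b [bm birr bd]] := IHk d.
- exact: leq_trans ltdq _.
- by rewrite ltn_neqAle eq_sym d1 size_poly_gt0.
by exists b; split=> //; apply: dvdp_trans bd dq.
Qed.

Section ReductionModP.
Variable p : nat.
Hypothesis p_prime : prime p.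

Lemma intr_Fp_eq0 (m : int) : (m%:~R == 0 :> 'F_p) = (p%:Z %| m)%Z.
Proof. by rewrite (dvdz_pcharf (pchar_Fp p_prime)). Qed.

Lemma reduce_mod_eqP (g h : {poly int}) :
  reduce_mod p g = reduce_mod p h -> exists r, g = h + p%:R * r.
Proof.
move=> gh; exists (\poly_(i < size (g - h)) ((g - h)`_i %/ p)%Z).
apply/eqP; rewrite addrC -subr_eq; apply/eqP/polyP => i.
rewrite -(rmorph_nat polyC) mulrC coefMC coef_poly; case: ltnP => [_|le].
  rewrite natz divzK // -intr_Fp_eq0; apply/eqP.
  have := congr1 (fun q : {poly 'F_p} => q`_i) gh.
  rewrite /reduce_mod !coef_map /= => ghi.
  by rewrite coefB rmorphB /= ghi subrr.
by rewrite mul0r nth_default.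
Qed.

Lemma monic_lift (q : {poly 'F_p}) : q \is monic ->
  exists g : {poly int}, [/\ g \is monic, reduce_mod p g = q & size g = size q].
Proof.
move=> qm; pose lift (x : 'F_p) : int := (x : nat)%:Z.
have lift0 : lift 0 = 0 by [].
have liftK x : (lift x)%:~R = x by rewrite /lift -pmulrn natr_Zp.
have lift1 : lift 1 = 1 by rewrite /lift /= modn_small.
exists (map_poly lift q); split.
- rewrite monicE lead_coef_map_id0 // (monicP qm) lift1 //.
- apply/polyP => i; rewrite /reduce_mod coef_map coef_map_id0 //; exact: liftK.
- by rewrite size_map_poly_id0 // (monicP qm) lift1.
Qed.

(** Peel the irreducible factors of g modulo p off one by one; each costs one
    factor c. With c = 1 the hypothesis says that V is beta V + pV for every
    beta; with c = x - a it allows the factor x - a to be exceptional. *)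
Lemma monic_pow_sub (V : lmodType {poly int}) (c : {poly int}) :
  (forall b, b \is monic -> irreducible_poly (reduce_mod p b) ->
     forall v : V, exists s t, c *: v = b *: s + p%:R *: t) ->
  forall g, g \is monic ->
  exists m, forall v : V, exists s t, c ^+ m *: v = g *: s + p%:R *: t.
Proof.
move=> cV g; have [k] := ubnP (size g); elim: k g => // k IHk g le_gk gm.
have [g1|ne_g1] := eqVneq (size g) 1%N.
  have -> : g = 1.
    by move/monicP: gm; rewrite (size1_polyC (eq_leq g1)) lead_coefC => ->.
  by exists 0 => v; exists v, 0; rewrite expr0 scaler0 addr0.
have rgm : reduce_mod p g \is monic by rewrite /reduce_mod monic_map.
have szr : size (reduce_mod p g) = size g.
  by rewrite /reduce_mod size_map_poly_id0 // (monicP gm) rmorph1 oner_eq0.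
have [|b [bm birr /dvdpP[h hE]]] :=
  @monic_irreducible_factor _ (reduce_mod p g).
  by rewrite szr ltn_neqAle eq_sym ne_g1 size_poly_gt0 monic_neq0.
have hm : h \is monic by move: rgm; rewrite hE monicMr.
have [B [Bm BE _]] := monic_lift bm; have [H [Hm HE szH]] := monic_lift hm.
have [r gE] : exists r, g = H * B + p%:R * r.
  by apply: reduce_mod_eqP; rewrite rmorphM /= HE BE.
have [|m mV] := IHk H _ Hm.
  rewrite szH; apply: leq_trans (_ : size g <= k)%N; last by [].
  rewrite -szr hE size_Mmonic ?monic_neq0 // -subn1.
  have := birr.1; case: (size b) => [|[|s]] // _.
  by rewrite !addnS subn1 /= ltnS leq_addr.
exists m.+1 => v; have [s [t st]] := mV v.
have [|s' [t' st']] := cV B Bm _ s; first by rewrite BE.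
exists s', (H *: t' + c *: t - r *: s').
have -> : c ^+ m.+1 *: v = H *: (c *: s) + p%:R *: (c *: t).
  by rewrite exprS -scalerA st scalerDr !scalerA ![c * _]mulrC.
rewrite st' gE scalerDr scalerDl !scalerA !(scalerDr, scalerN) !scalerA.
rewrite [H * _%:R]mulrC -!addrA; congr (_ + _).
by rewrite [RHS]addrC -!addrA addNr addr0.
Qed.

End ReductionModP.

Section FpQuotient.
Variables (p : nat) (a : int).
Hypothesis p_prime : prime p.
Local Notation Fq := (Fp_quot p a).
Local Notation Fx := (restrict_scalars (reduce_mod p)).
Local Notation rel :=
  (range (fun g : {poly 'F_p} => (('X - (a%:~R)%:P) * g : Fx))).

(** Classes are indexed by integers, which makes F_p[x] / (x - a) the group
    Z / p with b in Z[x] acting as b(a): see Fp_cls_eq0 and Fp_clsZ. *)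
Definition Fp_cls (m : int) : Fq :=
  \pi_(quot_mod rel) ((m%:~R)%:P : {poly 'F_p}).

Lemma Fp_relP (h : Fx) : h \in submod_span rel -> (h : {poly 'F_p}).[a%:~R] = 0.
Proof.
move=> hS; apply/eqP; move: h hS.
apply: (@submod_span_ind _ Fx _ (fun h : Fx => (h : {poly 'F_p}).[a%:~R] == 0)).
  split=> [|b u v /eqP u0 /eqP v0]; rewrite unfold_in; first by rewrite horner0.
  by rewrite hornerD [_ *: _]/(_ * _) hornerM u0 v0 mulr0 addr0.
by move=> _ [g _ <-]; rewrite unfold_in !hornerE subrr mul0r.
Qed.

Lemma Fp_cls_eq0 m : Fp_cls m = 0 <-> (p %| m)%Z.
Proof.
rewrite -(intr_Fp_eq0 p_prime); split=> [/quot_mod_pi_eq0/Fp_relP|/eqP m0].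
  by rewrite hornerC => ->.
by rewrite /Fp_cls m0; apply/quot_mod_pi_eq0; exact: rpred0.
Qed.

Lemma Fp_clsD m m' : Fp_cls (m + m') = Fp_cls m + Fp_cls m'.
Proof. by rewrite /Fp_cls rmorphD polyCD -quot_mod_piD. Qed.

Lemma Fp_cls_pi (h : Fx) (m : int) : (h : {poly 'F_p}).[a%:~R] = m%:~R ->
  \pi_(quot_mod rel) h = Fp_cls m.
Proof.
move=> hm; apply/eqP; rewrite quot_mod_eq; apply: submod_span_gen.
have /factor_theorem[g gE] : root ((h : {poly 'F_p}) - (m%:~R)%:P) a%:~R.
  by rewrite /root !hornerE hm subrr.
by exists g => //; rewrite mulrC -gE.
Qed.

Lemma Fp_cls_surj q : exists m, q = Fp_cls m.
Proof.
have [h ->] := quot_mod_pi_surj q.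
exists ((h : {poly 'F_p}).[a%:~R] : nat)%:Z; apply: Fp_cls_pi.
by rewrite -pmulrn natr_Zp.
Qed.

Lemma Fp_clsZ b m : b *: Fp_cls m = Fp_cls (b.[a] * m).
Proof.
rewrite [LHS]quot_mod_piZ_scale; apply: Fp_cls_pi.
by rewrite [_ *: _]/(_ * _) hornerM hornerC horner_map rmorphM.
Qed.

End FpQuotient.

(** * Reading the local structure off the base changes *)

Lemma ideal_exp_gen2_mod (A : comNzRingType) (x y a : A) k :
  a \in ideal_exp (ideal_gen [set x; y]) k ->
  exists s t, a = x * s + y ^+ k * t.
Proof.
elim: k a => [|k IHk] a; first by exists 0, a; rewrite mulr0 add0r mul1r.
move=> /ideal_exp_gen2[s [_ [_ /IHk[s' [t ->]] ->]]].
exists (s + y * s'), t; rewrite exprS; ring.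
Qed.

Section LocalStructure.
Variables (p : nat) (V : lmodType {poly int}).
Hypothesis p_prime : prime p.
Local Notation P := (p%:R : {poly int}).

(** Modulo p, g is a product of polynomials beta with V = beta V + pV; hence
    V = gV + pV, which is pV. *)
Lemma local_structure_of_base_change0 (g : {poly int}) :
  g \is monic -> (forall v : V, g *: v = 0) ->
  (forall beta : {poly int}, beta \is monic ->
     irreducible_poly (reduce_mod p beta) ->
     mod_iso (mod_compl V p beta) (zero_mod {poly int})) ->
  forall v : V, exists t, v = P *: t.
Proof.
move=> gm gV V0 v.
have [|m mV] := @monic_pow_sub p p_prime V 1 _ g gm.
  move=> b bm birr w; have [s [t ->]] := base_change0_gen2 (V0 b bm birr) w.
  by exists t, s; rewrite scale1r addrC.
have [s [t]] := mV v; rewrite expr1n scale1r gV add0r => ->.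
by exists t.
Qed.

(** The submodules pV and p^2 V are not known to contain a power of I times V
    at the start. The factorisation of g gives (x - a)^m V in pV, hence I^m V in
    pV; since x - a kills the base change, (x - a) V is in pV; this in turn puts
    I^2 V in p^2 V, and p kills the base change too. *)
Lemma local_structure_of_base_change_Fp (g : {poly int}) (a : int) :
  g \is monic -> (forall v : V, g *: v = 0) ->
  mod_iso (mod_compl V p ('X - a%:P)) (Fp_quot p a) ->
  (forall beta : {poly int}, beta \is monic ->
     irreducible_poly (reduce_mod p beta) ->
     reduce_mod p beta <> reduce_mod p ('X - a%:P) ->
     mod_iso (mod_compl V p beta) (zero_mod {poly int})) ->
  (exists v0 : V, forall v, exists (m : int) s, v = m%:~R *: v0 + P *: s) /\
  (forall v : V, exists s, P *: v = P ^+ 2 *: s).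
Proof.
move=> gm gV [f fbij] V0; set c : {poly int} := 'X - a%:P in f fbij V0.
have ca : c.[a] = 0 by rewrite !hornerE subrr.
(* Opaque from here on, lest rewriting distribute over X - a. *)
clearbody c.
have [f' fK f'K] := fbij.
pose mulP (y : {poly int}) : {pred V} :=
  fun v => `[< exists s t, v = y *: s + 0 *: t >].
have mulPcl y : submod_closed (mulP y) := mulmod_closed V y 0.
have mulPP (y : {poly int}) (v : V) :
    reflect (exists s, v = y *: s) (v \in mulP y).
  apply: (iffP (asboolP _)) => [[s [t ->]]|[s ->]].
    by exists s; rewrite scale0r addr0.
  by exists s, 0; rewrite scale0r addr0.
have killed b : (p %| b.[a])%Z -> forall t : mod_compl V p c, b *: t = 0.
  move=> pb t; rewrite -[LHS]fK linearZ /=; have [m ->] := Fp_cls_surj (f t).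
  rewrite Fp_clsZ // -[RHS]fK linear0; congr f'.
  by apply/(Fp_cls_eq0 _ p_prime); rewrite dvdz_mulr.
have [|m mV] := @monic_pow_sub p p_prime V c _ g gm.
  move=> b bm birr w.
  have [bc|nbc] := pselect (reduce_mod p b = reduce_mod p c).
    have [r ->] := reduce_mod_eqP p_prime bc.
    exists w, (- (r *: w)).
    by rewrite scalerDl -scalerA -addrA scalerN subrr addr0.
  have [s [t ->]] := base_change0_gen2 (V0 b bm birr nbc) (c *: w).
  by exists t, s; rewrite addrC.
have cV (v : V) : exists s, c *: v = P *: s.
  apply/mulPP; apply: (base_change_ann (k := m) (mulPcl P)); last first.
    by apply: killed; rewrite ca.
  move=> b w /ideal_exp_gen2_mod[s [t ->]]; apply/mulPP.
  have [s' [t']] := mV (t *: w); rewrite gV add0r => E.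
  by exists (s *: w + t'); rewrite scalerDl -!scalerA E scalerDr.
split; last first.
  move=> v; apply/mulPP.
  apply: (base_change_ann (k := 2) (mulPcl (P ^+ 2))); last first.
    by apply: killed; rewrite -(rmorph_nat polyC) hornerC natz.
  move=> _ w /ideal_exp_gen2[_ [_ [/ideal_exp_gen2[s [t [_ _ ->]]] 
    /ideal_exp_gen2[s' [t' [_ _ ->]]] ->]]]; apply/mulPP.
  have [z1 E1] := cV ((t + s') *: w); have [z2 E2] := cV (t' *: w).
  have [z3 E3] := cV z2.
  exists (s *: w + z1 + z3).
  have -> : P * (P * s + c * t) + c * (P * s' + c * t') =
    P ^+ 2 * s + P * (c * (t + s')) + c * (c * t') by ring.
  rewrite 2!scalerDl -!scalerA E1 E2 [c *: (P *: _)]scalerA mulrC -scalerA E3.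
  by rewrite !scalerA -!expr2 !scalerDr scalerA.
have [e eE] : exists e : mod_compl V p c, f e = Fp_cls p a 1.
  by exists (f' (Fp_cls p a 1)).
have [||v0 v0E] := base_change_gen (k := 1) (t0 := e)
    (C := [set b | exists m : int, b = m%:~R]) (mulPcl P).
- move=> b w /ideal_exp_gen2_mod[s [t ->]]; apply/mulPP.
  have [z E] := cV (t *: w).
  by exists (s *: w + z); rewrite expr1 scalerDl -!scalerA E scalerDr.
- move=> t; have [k kE] := Fp_cls_surj (f t).
  exists k%:~R; first by exists k.
  apply: (can_inj fK); rewrite linearZ /= eE Fp_clsZ // kE.
  by rewrite -(rmorph_int polyC) hornerC mulr1 intz.
exists v0 => v; have [_ [k ->] /mulPP[s E]] := v0E v.
by exists k, s; rewrite -E addrC subrK.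
Qed.

End LocalStructure.

(** * Computing the base changes from the local structure *)

Section BaseChangeOfLine.
Variables (p : nat) (V : lmodType {poly int}).
Hypothesis p_prime : prime p.
Local Notation P := (p%:R : {poly int}).

Lemma prime_not_dvdz_Bezout_ring (R : pzRingType) (w : int) :
  ~~ (p%:Z %| w)%Z -> exists s t : int, s%:~R * w%:~R = 1 - t%:~R * p%:R :> R.
Proof.
move=> /(prime_not_dvdz_Bezout p_prime)[s [t st]]; exists s, t.
have := congr1 (fun m : int => m%:~R : R) st.
by rewrite rmorphD !rmorphM rmorph1 /= -pmulrn => /(canRL (addrK _)).
Qed.

(** Some multiple of u is congruent to 1 modulo p, hence modulo (p, beta). *)
Lemma base_change_eq0_coprime (u : int) (beta : {poly int}) :
  ~~ (p%:Z %| u)%Z -> (forall v : V, u%:~R *: v = 0) ->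
  mod_iso (mod_compl V p beta) (zero_mod {poly int}).
Proof.
move=> pu uV; have [s [t st]] := prime_not_dvdz_Bezout_ring {poly int} pu.
apply: base_change_eq0 => v; exists (t%:~R * P).
  by apply/ideal_gen2P; exists t%:~R, 0; rewrite mul0r addr0.
by rewrite -st -scalerA uV scaler0.
Qed.

Variables (u a : int) (v0 : V).
Hypothesis pu : ~~ (p%:Z %| u)%Z.
Hypothesis upV : forall v : V, (u%:~R * P) *: v = 0.
Hypothesis XaV : forall v : V, exists s, ('X - a%:P) *: v = P *: s.

(** Irreducibility makes beta(a) prime to p, since a root a modulo p would force
    beta = x - a modulo p; so x - a, and u (x - a) with it, is invertible modulo
    (p, beta). As (x - a) V is in pV and u p kills V, u (x - a) kills V. *)
Lemma base_change_eq0_other (beta : {poly int}) :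
  beta \is monic -> irreducible_poly (reduce_mod p beta) ->
  reduce_mod p beta <> reduce_mod p ('X - a%:P) ->
  mod_iso (mod_compl V p beta) (zero_mod {poly int}).
Proof.
move=> bm [b1 birr] nb; have pb : ~~ (p%:Z %| beta.[a])%Z.
  apply/negP; rewrite -(intr_Fp_eq0 p_prime) => pb; apply: nb.
  have XaE : reduce_mod p ('X - a%:P) = 'X - (a%:~R)%:P.
    by rewrite /reduce_mod rmorphB /= map_polyX map_polyC.
  have ba : root (reduce_mod p beta) a%:~R.
    by rewrite /root /reduce_mod horner_map.
  apply/esym/eqP; rewrite XaE -eqp_monic ?monicXsubC //; last first.
    by rewrite /reduce_mod monic_map.
  by apply: birr; rewrite ?size_XsubC // dvdp_XsubCl.
have [s [t st]] := prime_not_dvdz_Bezout_ring {poly int} pu.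
have [s' [t' st']] := prime_not_dvdz_Bezout_ring {poly int} pb.
have /factor_theorem[h hE] : root (beta - (beta.[a])%:P) a.
  by rewrite /root !hornerE subrr.
apply: base_change_eq0 => v.
pose T := t%:~R : {poly int}; pose S := s%:~R : {poly int}.
pose T' := t'%:~R : {poly int}; pose S' := s'%:~R : {poly int}.
have SE : S * u%:~R = 1 - T * P by [].
have SE' : - (S' * h * ('X - a%:P)) = 1 - T' * P - S' * beta.
  rewrite -mulrA -hE mulrBr opprB; congr (_ - _).
  by rewrite -[RHS]st' -(rmorph_int polyC beta.[a]) intz.
exists ((T' + T - T * (T' * P + S' * beta)) * P + S' * beta).
  by apply/ideal_gen2P; exists (T' + T - T * (T' * P + S' * beta)), S'.
have -> : 1 - ((T' + T - T * (T' * P + S' * beta)) * P + S' * beta) =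
          (1 - T * P) * (1 - T' * P - S' * beta) by ring.
have [w wE] := XaV v.
rewrite -SE -SE'.
have -> : S * u%:~R * - (S' * h * ('X - a%:P)) =
          - (S * u%:~R * S' * h) * ('X - a%:P) by ring.
rewrite -scalerA wE scalerA.
have -> : - (S * u%:~R * S' * h) * P = - (S * S' * h) * (u%:~R * P) by ring.
by rewrite -scalerA upV scaler0.
Qed.

Hypothesis v0_gen : forall v : V, exists (m : int) s, v = m%:~R *: v0 + P *: s.
Hypothesis v0_free : forall (m : int) s, m%:~R *: v0 = P *: s -> (p %| m)%Z.

(** The coefficient k of v0 in a vector of V modulo pV is a linear form to
    F_p[x] / (x - a) and extends to the base change. There, multiples of p
    vanish because a multiple of u lies in 1 + I, and x - a maps V into pV, so
    every tensor is an integer multiple of v0 tensor 1. *)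
Lemma base_change_Fp : mod_iso (mod_compl V p ('X - a%:P)) (Fp_quot p a).
Proof.
have /choice[k kE] := v0_gen.
have kP v m s : v = m%:~R *: v0 + P *: s -> Fp_cls p a (k v) = Fp_cls p a m.
  move=> vE; have [s' vE'] := kE v; apply/eqP; rewrite -subr_eq0; apply/eqP.
  have -> : Fp_cls p a (k v) - Fp_cls p a m = Fp_cls p a (k v - m).
    by apply/eqP; rewrite subr_eq -Fp_clsD subrK.
  apply/(Fp_cls_eq0 a p_prime)/(v0_free (s := s - s')).
  rewrite rmorphB scalerBl scalerBr; apply/eqP.
  by rewrite subr_eq addrAC -subr_eq opprK -vE' addrC -vE.
have Fp_clsM b m : Fp_cls p a (b * m) = b%:P *: Fp_cls p a m.
  by rewrite Fp_clsZ hornerC.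
have Xav0 b : exists s, b *: v0 = (b.[a])%:~R *: v0 + P *: s.
  have /factor_theorem[h hE] : root (b - (b.[a])%:P) a.
    by rewrite /root !hornerE subrr.
  have [s sE] := XaV v0; exists (h *: s).
  rewrite scalerA mulrC -scalerA -sE scalerA -hE -scalerDl.
  by rewrite -(rmorph_int polyC) intz addrC subrK.
have [phi phiE] : exists phi : {linear V -> Fp_quot p a},
    phi =1 (fun v => Fp_cls p a (k v)).
  apply: linear_bundle => b v w; rewrite Fp_clsZ -Fp_clsD.
  have [s vE] := kE v; have [t wE] := kE w; have [z zE] := Xav0 b.
  apply: (kP _ _ (b *: s + (k v)%:~R *: z + t)).
  have -> : b *: v = (b.[a] * k v)%:~R *: v0 + P *: (b *: s + (k v)%:~R *: z).
    rewrite {1}vE !scalerDr !scalerA [b * _]mulrC -[(_ * b) *: _]scalerA zE.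
    rewrite scalerDr !scalerA -rmorphM [k v * _]mulrC [P * b]mulrC [P * _]mulrC.
    by rewrite -addrA [X in _ + X = _]addrC.
  by rewrite {1}wE rmorphD scalerDl [in RHS]scalerDr addrACA.
have phiP s : phi (P *: s) = 0.
  rewrite phiE (kP _ 0 s) ?scale0r ?add0r //; exact/(Fp_cls_eq0 a p_prime).
have [|Phi PhiE] :=
  @base_change_lift _ V (ideal_gen [set P; 'X - a%:P]) _ phi 1.
  move=> b v /ideal_exp_gen2_mod[s [t ->]].
  have [z zE] := XaV (t *: v).
  by rewrite expr1 scalerDl -!scalerA zE linearD !phiP addr0.
pose R := completion (ideal_gen [set P; 'X - a%:P]).
have tensP (s : V) (r : R) : tens (P *: s) r = 0.
  have [x [y xy]] := prime_not_dvdz_Bezout_ring {poly int} pu.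
  apply: (@tens_ann0 _ _ _ _ _ (y%:~R * P)).
    by apply/ideal_gen2P; exists y%:~R, 0; rewrite mul0r addr0.
  rewrite -xy scalerA -mulrA -scalerA. by rewrite upV scaler0.
have gen (t : mod_compl V p ('X - a%:P)) : exists m : int,
    t = m%:~R *: tens v0 (cmpl_const _ 1).
  elim/tens_ind: t => [|s t [m ->] [m' ->]|v r].
  - by exists 0; rewrite scale0r.
  - by exists (m + m'); rewrite rmorphD scalerDl.
  have [m [s ->]] := v0_gen v; rewrite tensDl tensP addr0 tensZl.
  have [b [x [y ->]]] := cmpl_const_mod_gen2 r.
  rewrite !tensDr ![tens _ (_ *: _)]tensZr -![_ *: tens _ _]tensZl tensP add0r.
  have [z ->] := XaV v0; rewrite tensP addr0.
  have [w ->] := Xav0 b; rewrite tensDl tensP addr0 tensZl scalerA -rmorphM.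
  by exists (m * b.[a]).
exists Phi; apply: inj_surj_bijective => [|q].
  suff Phi0 t : Phi t = 0 -> t = 0.
    move=> s t st; apply/eqP; rewrite -subr_eq0; apply/eqP/Phi0.
    by rewrite linearB st subrr.
  have [m ->] := gen t; rewrite linearZ /= PhiE scale1r phiE.
  rewrite (kP _ 1 0) ?scaler0 ?addr0 ?scale1r // Fp_clsZ.
  rewrite -(rmorph_int polyC) hornerC mulr1 intz => /(Fp_cls_eq0 a p_prime).
  case/dvdzP=> m' ->; rewrite rmorphM /= -scalerA -tensZl.
  have -> : (p%:Z)%:P = P by rewrite -(rmorph_nat polyC) natz.
  rewrite tensP.
  by rewrite scaler0.
have [m ->] := Fp_cls_surj q; exists (m%:~R *: tens v0 (cmpl_const _ 1)).
rewrite linearZ /= PhiE scale1r phiE (kP _ 1 0) ?scaler0 ?addr0 ?scale1r //.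
by rewrite Fp_clsZ -(rmorph_int polyC) hornerC mulr1 intz.
Qed.

End BaseChangeOfLine.

(** * The walk cokernel as the cokernel of the walk matrix *)

Section WalkCokernel.
Variables (n' : nat) (M : 'M[int]_n'.+1) (zeta : 'cV[int]_n'.+1).
Local Notation n := n'.+1.
Local Notation Zx := {poly int}.
Local Notation V := (walk_coker M zeta).
Local Notation W := (walk_matrix M zeta).
Local Notation const := (map_mx polyC).
Local Notation B := (row_mx (const M - 'X%:M) (const zeta)).

Lemma walk_matrix_mul (t : 'cV[int]_n) :
  W *m t = \sum_(j < n) t j 0 *: (M ^+ j *m zeta).
Proof.
apply/colP => i; rewrite mxE summxE; apply: eq_bigr => j _.
by rewrite !mxE mulrC.
Qed.

(** By Cayley-Hamilton, a can be replaced by its remainder modulo the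
    characteristic polynomial, whose coefficients give t. *)
Lemma walk_matrix_krylov (a : Zx) : exists t, horner_mx M a *m zeta = W *m t.
Proof.
have chi_mon := char_poly_monic M.
rewrite (Pdiv.RingMonic.rdivp_eq chi_mon a).
set r := Pdiv.Ring.rmodp _ _.
have szr : (size r <= n)%N.
  rewrite -ltnS -(size_char_poly M) Pdiv.Ring.ltn_rmodp.
  exact: monic_neq0.
exists (\col_j r`_j).
rewrite rmorphD rmorphM /= Cayley_Hamilton mulr0 add0r walk_matrix_mul.
have -> : r = \poly_(j < n) r`_j.
  apply/polyP => j; rewrite coef_poly; case: ltnP => // le_nj.
  by rewrite nth_default // (leq_trans szr).
rewrite poly_def linear_sum /= mulmx_suml; apply: eq_bigr => j _.
rewrite linearZ /= rmorphXn /= horner_mx_X -scalemxAl; congr (_ *: _).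
by rewrite mxE -poly_def coef_poly ltn_ord.
Qed.

Definition walk_cls (z : 'cV[int]_n) : V := \pi_V (const z).

Lemma walk_clsD : {morph walk_cls : y z / y + z}.
Proof. by move=> y z; rewrite /walk_cls map_mxD quot_mod_piD. Qed.

Lemma walk_clsZX z : 'X *: walk_cls z = walk_cls (M *m z).
Proof.
rewrite /walk_cls [LHS]quot_mod_piZ_scale; apply/eqP.
rewrite -[_ == _]/(_ == \pi_(quot_mod _) _) quot_mod_eq.
apply: submod_span_gen.
exists (col_mx (- const z) 0) => //.
rewrite mul_row_col mulmx0 addr0 mulmxN mulmxBl map_mxM opprB.
by rewrite mul_scalar_mx.
Qed.

Lemma walk_cls_zeta : walk_cls zeta = 0.
Proof.
apply/quot_mod_pi_eq0/submod_span_gen; exists (col_mx 0 1%:M) => //.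
by rewrite mul_row_col mulmx0 add0r mulmx1.
Qed.

Lemma walk_clsZ a z : a *: walk_cls z = walk_cls (horner_mx M a *m z).
Proof.
have clsC c y : c%:P *: walk_cls y = walk_cls (c *: y).
  by rewrite /walk_cls [LHS]quot_mod_piZ_scale map_mxZ.
elim/poly_ind: a z => [|q c IHq] z.
  by rewrite rmorph0 mul0mx -[0 in RHS](scale0r z) -clsC polyC0 !scale0r.
rewrite scalerDl -scalerA walk_clsZX IHq clsC -walk_clsD.
rewrite rmorphD rmorphM /= horner_mx_X horner_mx_C mulmxDl mul_scalar_mx.
by rewrite mulmxA.
Qed.

Lemma col_sum_const (v : 'cV[Zx]_n) :
  v = \sum_i v i 0 *: const (delta_mx i 0 : 'cV[int]_n).
Proof.
apply/colP => i; rewrite summxE (bigD1 i) //= big1 => [|j ne_ji].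
  by rewrite !mxE !eqxx mulr1 addr0.
by rewrite !mxE eq_sym (negPf ne_ji) /= mulr0.
Qed.

(** Acting on a constant vector, a polynomial in x can be replaced by the same
    polynomial in M. *)
Lemma walk_cls_surj (v : V) : exists z, v = walk_cls z.
Proof.
have [u ->] := quot_mod_pi_surj v; rewrite (col_sum_const u).
elim/big_ind: _ => [|x y [z xz] [z' yz]|i _].
- by exists 0; rewrite /walk_cls map_mx0.
- by exists (z + z'); rewrite walk_clsD -xz -yz quot_mod_piD.
- by exists (horner_mx M (u i 0) *m delta_mx i 0);
    rewrite -walk_clsZ /walk_cls [RHS]quot_mod_piZ_scale.
Qed.

(** The substitution x := M, from Z[x]^n to Z^n: it kills the columns of
    M - x I and inverts walk_cls up to W Z^n. *)
Definition eval_at_M (v : 'cV[Zx]_n) : 'cV[int]_n :=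
  \sum_i horner_mx M (v i 0) *m delta_mx i 0.

Lemma eval_at_MD u v : eval_at_M (u + v) = eval_at_M u + eval_at_M v.
Proof.
rewrite /eval_at_M -big_split; apply: eq_bigr => i _.
by rewrite mxE rmorphD mulmxDl.
Qed.

Lemma eval_at_MZ a v : eval_at_M (a *: v) = horner_mx M a *m eval_at_M v.
Proof.
rewrite /eval_at_M mulmx_sumr; apply: eq_bigr => i _.
by rewrite mxE rmorphM mulmxA.
Qed.

Lemma eval_at_M_const z : eval_at_M (const z) = z.
Proof.
rewrite [RHS](matrix_sum_delta z); apply: eq_bigr => i _.
by rewrite big_ord1 mxE horner_mx_C mul_scalar_mx.
Qed.

Lemma walk_cls_eq0 z : walk_cls z = 0 <-> exists t, z = W *m t.
Proof.
split=> [/quot_mod_pi_eq0 zB|[t ->]]; last first.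
  rewrite walk_matrix_mul; elim/big_ind: _ => [|x y x0 y0|j _].
  - by rewrite /walk_cls map_mx0; apply/quot_mod_pi_eq0/rpred0.
  - by rewrite walk_clsD x0 y0 addr0.
  - rewrite scalemxAl (_ : _ *: _ = horner_mx M (t j 0 *: 'X^j)); last first.
      by rewrite linearZ /= rmorphXn /= horner_mx_X.
    by rewrite -walk_clsZ walk_cls_zeta scaler0.
suff: `[< exists t, eval_at_M (const z) = W *m t >].
  by rewrite eval_at_M_const => /asboolP.
move: (const z) zB.
apply: (@submod_span_ind _ _ _
  (fun v => `[< exists t, eval_at_M v = W *m t >])).
  split=> [|a u v /asboolP[s us] /asboolP[t vt]]; apply/asboolP.
    exists 0; rewrite mulmx0 -[0 in LHS](scale0r 0) eval_at_MZ rmorph0.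
    by rewrite mul0mx.
  rewrite eval_at_MD eval_at_MZ us vt walk_matrix_mul mulmx_sumr.
  have /choice[F FE] : forall j : 'I_n, exists r,
      horner_mx M a *m (s j 0 *: (M ^+ j *m zeta)) = W *m r.
    move=> j; have [r rE] := walk_matrix_krylov (a * (s j 0 *: 'X^j)).
    have hE : horner_mx M (s j 0 *: 'X^j) = s j 0 *: M ^+ j.
      by rewrite linearZ /= rmorphXn /= horner_mx_X.
    by exists r; rewrite -rE rmorphM /= hE scalemxAl mulmxA.
  exists (\sum_j F j + t); rewrite mulmxDr mulmx_sumr; congr (_ + _).
  by apply: eq_bigr.
move=> _ [u _ <-]; apply/asboolP; rewrite -[u]vsubmxK mul_row_col.
set u1 := usubmx u; set u2 := dsubmx u; rewrite eval_at_MD.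
have -> : eval_at_M ((const M - 'X%:M) *m u1) = 0.
  rewrite (col_sum_const u1) mulmx_sumr.
  elim/big_ind: _ => [|x y x0 y0|i _].
  - by rewrite -[0 in LHS](scale0r 0) eval_at_MZ rmorph0 mul0mx.
  - by rewrite eval_at_MD x0 y0 addr0.
  rewrite -scalemxAr eval_at_MZ mulmxBl mul_scalar_mx -map_mxM -scaleN1r.
  rewrite eval_at_MD !eval_at_MZ !eval_at_M_const horner_mx_X rmorphN1.
  by rewrite mulNmx mul1mx subrr mulmx0.
rewrite add0r [u2]mx11_scalar mul_mx_scalar eval_at_MZ eval_at_M_const.
exact: walk_matrix_krylov.
Qed.

End WalkCokernel.

Section WalkCokernelLocal.
Variables (n' p : nat) (M : 'M[int]_n'.+1) (zeta : 'cV[int]_n'.+1).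
Hypothesis p_prime : prime p.
Local Notation n := n'.+1.
Local Notation V := (walk_coker M zeta).
Local Notation W := (walk_matrix M zeta).
Local Notation cls := (walk_cls M zeta).
Local Notation P := (p%:R : {poly int}).

Lemma walk_clsZz (m : int) z : m%:~R *: cls z = cls (m *: z).
Proof.
by rewrite -(rmorph_int polyC) intz walk_clsZ horner_mx_C mul_scalar_mx.
Qed.

Lemma walk_clsZP z : P *: cls z = cls (p%:Z *: z).
Proof. by rewrite -walk_clsZz -pmulrn. Qed.

Lemma walk_cls_eq y z : cls y = cls z <-> exists t, y = z + W *m t.
Proof.
split=> [yz|[t ->]].
  have /walk_cls_eq0[t tE] : cls (y - z) = 0.
    by rewrite walk_clsD -scaleN1r -walk_clsZz yz rmorphN1 scaleN1r subrr.
  by exists t; rewrite -tE addrC subrK.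
rewrite walk_clsD [cls (W *m t)](_ : _ = 0) ?addr0 //.
by apply/walk_cls_eq0; exists t.
Qed.

Lemma walk_det_kills (v : V) : (\det W)%:~R *: v = 0.
Proof.
have [z ->] := walk_cls_surj v; rewrite walk_clsZz; apply/walk_cls_eq0.
by exists (\adj W *m z); rewrite mulmxA mul_mx_adj mul_scalar_mx.
Qed.

Lemma walk_char_poly_kills (v : V) : char_poly M *: v = 0.
Proof.
have [z ->] := walk_cls_surj v; rewrite walk_clsZ Cayley_Hamilton mul0mx.
by apply/walk_cls_eq0; exists 0; rewrite mulmx0.
Qed.

Lemma walk_det_not_dvd_sqr :
  (exists v0 : V, forall v, exists (m : int) s, v = m%:~R *: v0 + P *: s) ->
  (forall v : V, exists s, P *: v = P ^+ 2 *: s) ->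
  ~~ ((p ^ 2)%N%:Z %| \det W)%Z.
Proof.
move=> [v0 cyc] pV; apply: det_not_dvd_sqr => //; last first.
  move=> z; have [s] := pV (cls z); have [y ->] := walk_cls_surj s.
  rewrite expr2 -scalerA !walk_clsZP => /walk_cls_eq[t ->].
  by exists y, t; rewrite expnS expn1 PoszM scalerA.
have [z0 z0E] := walk_cls_surj v0; exists z0 => z.
have [m [s]] := cyc (cls z); have [y ->] := walk_cls_surj s.
rewrite z0E walk_clsZz walk_clsZP -walk_clsD => /walk_cls_eq[t ->].
by exists m, y, t; rewrite addrA.
Qed.

(** The scalar a is read off from the image of a generator z0 of V / pV: as
    M z0 = a z0 modulo pV, x acts as a on the whole line. *)
Lemma walk_coker_line :
  (p%:Z %| \det W)%Z -> ~~ ((p ^ 2)%N%:Z %| \det W)%Z ->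
  exists (u a : int) (v0 : V),
    [/\ ~~ (p%:Z %| u)%Z, forall v : V, (u%:~R * P) *: v = 0,
        forall v : V, exists s, ('X - a%:P) *: v = P *: s,
        forall v : V, exists (m : int) s, v = m%:~R *: v0 + P *: s &
        forall (m : int) (s : V), m%:~R *: v0 = P *: s -> (p%:Z %| m)%Z].
Proof.
move=> pd ppd; have [w [z0 [wz0 wW wker]]] := coker_mod_p_line p_prime pd ppd.
have [u uE] := dvdzP pd.
pose l (z : 'cV[int]_n) : int := (w *m z) 0 0.
have lD y z : l (y + z) = l y + l z by rewrite /l mulmxDr mxE.
have lZ (m : int) z : l (m *: z) = m * l z by rewrite /l -scalemxAr mxE.
have gen z : exists s, cls z = (l z)%:~R *: cls z0 + P *: s.
  have [|s [t E]] := wker (z - l z *: z0).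
    by rewrite -/(l _) -scaleNr lD lZ [l z0]wz0 mulr1 subrr dvdz0.
  exists (cls s); rewrite walk_clsZz walk_clsZP -walk_clsD; apply/walk_cls_eq.
  by exists t; rewrite -addrA -E addrC subrK.
exists u, (l (M *m z0)), (cls z0); split.
- by apply: contra ppd => pu; rewrite uE expnS expn1 PoszM dvdz_mul.
- by move=> v; rewrite -[RHS](walk_det_kills v) uE intrM -pmulrn.
- move=> v; have [z ->] := walk_cls_surj v; have [s ->] := gen z.
  have [t tE] := gen (M *m z0); set a := l (M *m z0) in tE *.
  exists ((l z)%:~R *: t + ('X - a%:P) *: s).
  rewrite !scalerDr scalerA mulrC -scalerA scalerBl walk_clsZX tE.
  rewrite -(rmorph_int polyC a) intz [_ + P *: t]addrC addrK.
  by rewrite !scalerA mulrC [_ * P]mulrC.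
- move=> v; have [z ->] := walk_cls_surj v; have [s E] := gen z.
  by exists (l z), s.
move=> m s; have [y ->] := walk_cls_surj s; rewrite walk_clsZz walk_clsZP.
case/walk_cls_eq=> t /(congr1 l); rewrite lD !lZ {1}/l wz0 mulr1 => ->.
by apply: rpredD; rewrite ?wW // dvdz_mulr.
Qed.

End WalkCokernelLocal.

Theorem proposition3p2 (n p : nat) (zeta : 'cV[int]_n) (M : 'M[int]_n)
    (p_prime : prime p) :
  ~ (((p ^ 2)%N%:Z %| \det (walk_matrix M zeta))%Z) <->
  (forall beta : {poly int}, beta \is monic ->
     irreducible_poly (reduce_mod p beta) ->
     mod_iso (mod_compl (walk_coker M zeta) p beta) (zero_mod {poly int}))
  \/
  (exists a : int,
     mod_iso (mod_compl (walk_coker M zeta) p ('X - a%:P)) (Fp_quot p a) /\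
     forall beta : {poly int}, beta \is monic ->
       irreducible_poly (reduce_mod p beta) ->
       reduce_mod p beta <> reduce_mod p ('X - a%:P) ->
       mod_iso (mod_compl (walk_coker M zeta) p beta) (zero_mod {poly int})).
Proof.
case: n zeta M => [|n] zeta M.
  (* For n = 0 the module is zero and the empty determinant is 1. *)
  have V0 (v : walk_coker M zeta) : v = 0.
    have [u ->] := quot_mod_pi_surj v; apply/quot_mod_pi_eq0.
    by rewrite flatmx0 rpred0.
  split=> [_|_]; last first.
    rewrite det_mx00 dvdzE dvdn1 expnS muln_eq1 => /andP[/eqP p1 _].
    by move: p_prime; rewrite p1.
  left=> beta _ _; apply: base_change_eq0 => v; exists 0.
    by apply/ideal_gen2P; exists 0, 0; rewrite !mul0r addr0.
  by rewrite (V0 v) scaler0.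
have kill := @walk_det_kills n M zeta.
have chi_m := char_poly_monic M; have chi0 := @walk_char_poly_kills n M zeta.
split=> [/negP ppd|].
  have [pd|npd] := boolP (p%:Z %| \det (walk_matrix M zeta))%Z; last first.
    by left=> beta _ _; apply: base_change_eq0_coprime npd kill.
  have [u [a [v0 [pu upV XaV gen free]]]] := walk_coker_line p_prime pd ppd.
  right; exists a; split.
    exact: (base_change_Fp p_prime pu upV XaV gen free).
  exact: (base_change_eq0_other p_prime pu upV XaV).
have VpV := local_structure_of_base_change0 p_prime chi_m chi0.
case=> [V0|[a [Va V0]]]; apply/negP; apply: walk_det_not_dvd_sqr => //.
- exists 0 => v; have [s ->] := VpV V0 v.
  by exists 0, s; rewrite scaler0 add0r.
- move=> v; have [s ->] := VpV V0 v.
  by exists s; rewrite scalerA -expr2.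
- by have [] := local_structure_of_base_change_Fp p_prime chi_m chi0 Va V0.
- by have [] := local_structure_of_base_change_Fp p_prime chi_m chi0 Va V0.
Qed.
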